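(* Let $\mathbf{p}_n$ be a permutation of $[n]$ chosen uniformly at random. Then $$\lim_{n\to\infty}\Pr\big[\mathbf{p}_n \text{ contains a pair of twins of length at least } \tfrac{1}{80}n^{2/3}\big]=1.$$
   Context: A permutation of a finite set $\Sigma\subset\mathbb{N}$ is a sequence in which every element of $\Sigma$ appears exactly once; a subpermutation of a permutation is a subsequence of it. Two sequences $(a_1,\dots,a_L)$ and $(b_1,\dots,b_L)$ of distinct numbers are order-isomorphic if for all $i,j$: $a_i<a_j \iff b_i<b_j$. Two subpermutations of a permutation are called twins if they are order-isomorphic and disjoint (share no symbol); their length is their common number of entries. *)

(* Defs.v *)
From HB Require Import structures.
From mathcomp Require Import all_boot all_order all_algebra all_fingroup.
Set Implicit Arguments. Unset Strict Implicit. Unset Printing Implicit Defensive.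
Import Order.TTheory GRing.Theory Num.Theory.

Definition pseq (n : nat) (p : 'S_n) : seq nat := [seq val (p i) | i <- enum 'I_n].

Definition order_iso (s t : seq nat) : bool :=
  (size s == size t) &&
  all (fun i => all (fun j => (nth 0 s i < nth 0 s j) == (nth 0 t i < nth 0 t j))
                    (iota 0 (size s)))
      (iota 0 (size s)).

Definition twins (s t : seq nat) : bool :=
  order_iso s t && all (fun x => x \notin t) s.

(* p contains a pair of twins of length at least n^(2/3)/80, i.e. of length L
   with 80 L >= n^(2/3), i.e. (80 L)^3 >= n^2. *)
Definition has_long_twins (n : nat) (p : 'S_n) : bool :=
  [exists m1 : n.-tuple bool, exists m2 : n.-tuple bool,
     let s := mask m1 (pseq p) in let t := mask m2 (pseq p) in
     twins s t && (n ^ 2 <= (80 * size s) ^ 3)%N].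

Definition prob_long_twins (n : nat) : rat :=
  (#|[set p : 'S_n | has_long_twins p]|)%:R / (#|'S_n|)%:R.

(* Main.v *)
(* Cut positions and values into blocks of length b, where 8 b^3 <= n < 8 (b+1)^3.
   Pairs of points lying in a common cell, such that no other such pair lies in
   the same row or column of cells, can be split between two twins, because the
   order between points of distinct rows and columns is that of the blocks.
   The expected number of pairs in a common cell is about b^2/2, and the
   expected number of pairs lost to conflicts is about b^2/4, so the maximal
   length of twins has mean at least b^2/5, whereas n^(2/3)/80 < (b+1)^2/20.
   Composing the permutation with a transposition changes this maximal length
   by at most 2, whence its variance is at most 4 n = o(b^4), and Chebyshev's
   inequality concludes. *)
Require Import Defs.
From HB Require Import structures.
From mathcomp Require Import all_boot all_order all_algebra all_fingroup.
From mathcomp Require Import ring lra zify.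
Import Order.TTheory GRing.Theory Num.Theory.
Local Open Scope ring_scope.

(** * Variance of Lipschitz functions of a permutation *)

Section Variance.
Variables (R : realFieldType) (T : finType).
Implicit Types (f : {perm T} -> R) (g p q : {perm T}) (S : {set T}).

(** Sort the permutations by the image [y] of [x]: multiplying on the right by [tperm x y] turns
    those sending [x] to [y] into those fixing [x]. *)
Lemma sum_perm_onU1 f x S : x \notin S ->
  \sum_(p : {perm T} | perm_on (x |: S) p) f p =
  \sum_(y in x |: S) \sum_(q : {perm T} | perm_on S q) f (q * tperm x y)%g.
Proof.
move=> xS.
rewrite (partition_big (fun p : {perm T} => p x) (fun y => y \in x |: S)) /=; last first.
  by move=> p pS; rewrite perm_closed // setU11.
apply: eq_bigr => y yS.
rewrite (reindex_inj (mulIg (tperm x y))) /=; apply: eq_bigl => q.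
have tS : perm_on (x |: S) (tperm x y).
  apply/subsetP => z; rewrite inE; case: tpermP => [->|->|_ _]; rewrite ?setU11 //.
  by rewrite eqxx.
rewrite permM; apply/andP/idP => [[qS /eqP qx]|qS].
  have {}qx : q x = x by apply: (@perm_inj _ (tperm x y)); rewrite qx tpermL.
  have {}qS : perm_on (x |: S) q.
    by have := perm_onM qS tS; rewrite -mulgA tperm2 mulg1.
  apply/subsetP => z; rewrite inE => qz.
  have := subsetP qS z; rewrite !inE => /(_ qz) /orP [/eqP zx|//].
  by rewrite zx qx eqxx in qz.
rewrite (out_perm qS xS) tpermL eqxx; split=> //; apply: perm_onM tS.
by apply: (subset_trans qS); apply: subsetUr.
Qed.

(** The translate [g] is kept because the induction descends through cosets of smaller symmetric
    groups. *)
Let mean f S g := (#|S|`!%:R)^-1 * \sum_(p : {perm T} | perm_on S p) f (p * g)%g.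

(** Bias-variance decomposition: the cross term is a multiple of the vanishing sum. *)
Lemma sum_sqr_dev (I : finType) (P : pred I) (F : I -> R) (m c : R) :
  \sum_(i | P i) (F i - m) = 0 ->
  \sum_(i | P i) (F i - c) ^+ 2 =
  \sum_(i | P i) (F i - m) ^+ 2 + \sum_(i | P i) (m - c) ^+ 2.
Proof.
move=> F0; rewrite -big_split /=.
transitivity (\sum_(i | P i) ((F i - m) ^+ 2 + (m - c) ^+ 2 + (m - c) *+ 2 * (F i - m))).
  by apply: eq_bigr => i _; ring.
by rewrite big_split /= -mulr_sumr F0 mulr0 addr0.
Qed.

(* Sym (x |: S) splits into the cosets Sym S * tperm x y, and the conditional
   means over two cosets differ by at most L: each new point contributes at
   most L ^+ 2 to the variance. *)
Lemma perm_variance_on f (L : R) S g :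
  (forall p x y, `|f (p * tperm x y)%g - f p| <= L) ->
  \sum_(p : {perm T} | perm_on S p) (f (p * g)%g - mean f S g) ^+ 2
    <= (#|S| * #|S|`!)%:R * L ^+ 2.
Proof.
move=> fL; move eqn : #|S| => n; elim: n S g eqn => [|n IH] S g cS.
  have -> : S = set0 by apply/eqP; rewrite -cards_eq0 cS.
  rewrite /mean cards0 mul0n mul0r invr1 mul1r.
  have e (p : {perm T}) : perm_on set0 p = (p == 1%g).
    apply/idP/eqP => [p0|->]; last exact: perm_on1.
    by apply/permP => x; rewrite perm1 (out_perm p0) // inE.
  by rewrite !(big_pred1 1%g) // subrr expr0n.
have [x xS] : exists x, x \in S by apply/card_gt0P; rewrite cS.
pose S' := S :\ x.
have xS' : x \notin S' by rewrite !inE eqxx.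
have ES : S = x |: S' by rewrite setD1K.
have cS' : #|S'| = n by move: cS; rewrite (cardsD1 x) xS => -[].
have fact0 k : (k`!%:R : R) != 0 by rewrite pnatr_eq0 -lt0n fact_gt0.
have cSym (U : {set T}) : #|[pred p : {perm T} | perm_on U p]| = (#|U|`!)%N.
  exact: card_perm.
pose gy y := (tperm x y * g)%g.
pose m y := mean f S' (gy y).
have meanE (U : {set T}) h : \sum_(p : {perm T} | perm_on U p) (f (p * h)%g - mean f U h) = 0.
  rewrite sumrB sumr_const cSym -[mean f U h *+ _]mulr_natl /mean mulrA divff //.
  by rewrite mul1r subrr.
have m_bound y : `|m y - m x| <= L.
  rewrite /m /mean -mulrBr -sumrB normrM gtr0_norm ?invr_gt0 ?ltr0n ?fact_gt0 //.
  rewrite ler_pdivrMl ?ltr0n ?fact_gt0 // (le_trans (ler_norm_sum _ _ _)) //.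
  apply: (le_trans (y := \sum_(p : {perm T} | perm_on S' p) L)).
    apply: ler_sum => q _; rewrite /gy tperm1 mul1g.
    (* Conjugation by [g] moves the transposition to the far right, where the Lipschitz hypothesis
       applies. *)
    have -> : (q * (tperm x y * g) = q * g * tperm (g x) (g y))%g.
      by rewrite -tpermJ /conjg !mulgA mulgK.
    exact: fL.
  by rewrite sumr_const cSym -[L *+ _]mulr_natl.
have sumE (c : R) : \sum_(p : {perm T} | perm_on S p) (f (p * g)%g - c) ^+ 2 =
    \sum_(y in S) \sum_(q : {perm T} | perm_on S' q) (f (q * gy y)%g - c) ^+ 2.
  rewrite {1}ES (sum_perm_onU1 (fun p => (f (p * g)%g - c) ^+ 2)) // -ES.
  by apply: eq_bigr => y _; apply: eq_bigr => q _; rewrite /gy mulgA.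
(* The mean minimises the sum of squared deviations, so it may be replaced by the mean [m x] over a
   single coset. *)
apply: (le_trans (y := \sum_(p : {perm T} | perm_on S p) (f (p * g)%g - m x) ^+ 2)).
  rewrite [leRHS](sum_sqr_dev _ _ _ (mean f S g)) // lerDl.
  by apply: sumr_ge0 => i _; apply: sqr_ge0.
rewrite sumE; apply: (le_trans (y := \sum_(y in S) ((n * n`!)%:R * L ^+ 2 + n`!%:R * L ^+ 2))).
  apply: ler_sum => y _; rewrite (sum_sqr_dev _ _ _ (m y)) //.
  apply: lerD; first by apply: IH.
  rewrite sumr_const cSym cS' -[_ *+ n`!]mulr_natl ler_pM2l ?ltr0n ?fact_gt0 //.
  rewrite -[leLHS]real_normK ?num_real // lerXn2r ?nnegrE ?normr_ge0 //.
  exact: le_trans (m_bound y).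
rewrite sumr_const cS -mulrDl -natrD -[_ *+ n.+1]mulr_natl mulrA -natrM factS.
rewrite -mulSnr; exact: lexx.
Qed.

(** Divided by the number of permutations, this bounds the variance by [#|T| * L ^+ 2]. *)
Lemma perm_variance f (L : R) :
  (forall p x y, `|f (p * tperm x y)%g - f p| <= L) ->
  \sum_p (f p - (#|T|`!%:R)^-1 * \sum_q f q) ^+ 2 <= (#|T| * #|T|`!)%:R * L ^+ 2.
Proof.
move=> fL; have := @perm_variance_on f L [set: T] 1%g fL; rewrite /mean cardsT.
have onT (F : {perm T} -> R) : \sum_(p | perm_on setT p) F p = \sum_p F p.
  by apply: eq_bigl => p; rewrite [perm_on _ _](introT subsetP _) // => x; rewrite inE.
rewrite !onT.
have -> : \sum_p f (p * 1)%g = \sum_p f p by apply: eq_bigr => p _; rewrite mulg1.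
apply: le_trans; rewrite le_eqVlt; apply/orP; left; apply/eqP.
by apply: eq_bigr => p _; rewrite mulg1.
Qed.
End Variance.

(** * Twins as pairings of positions *)

Section TwinPairings.
Local Open Scope nat_scope.
Variable n : nat.
Implicit Types (p : 'S_n) (A : {set 'I_n * 'I_n}) (e : 'I_n * 'I_n).

(** The clause on positions makes both twins, read from left to right, list the pairs in the same
    order; the clause on values is then order isomorphism. *)
Definition compatible p e e' : bool :=
  [&& e.1 != e'.1, e.1 != e'.2, e.2 != e'.1, e.2 != e'.2,
      (e.1 < e'.1)%N == (e.2 < e'.2)%N & (p e.1 < p e'.1)%N == (p e.2 < p e'.2)%N].

(* A set of pairs (i, i'), meaning that the first twin uses position i where
   the second one uses i'.  All conditions are pairwise, so that the notion is
   inherited by subsets. *)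
Definition twin_pairing p A : bool :=
  [forall e in A, (e.1 != e.2) &&
     [forall e' in A, (e != e') ==> compatible p e e']].

Lemma twin_pairingP p A :
  reflect ((forall e, e \in A -> e.1 != e.2) /\
           (forall e e', e \in A -> e' \in A -> e != e' -> compatible p e e'))
          (twin_pairing p A).
Proof.
apply: (iffP forall_inP) => [H|[H1 H2] e eA].
  split=> [e /H /andP[]//|e e' eA e'A ne].
  by have /andP[_ /forall_inP /(_ _ e'A) /implyP] := H e eA; apply.
rewrite H1 //=; apply/forall_inP => e' e'A; apply/implyP; exact: H2.
Qed.

Definition max_twins p : nat := \max_(A | twin_pairing p A) #|A|.

Lemma card_twin_pairing_le p A : twin_pairing p A -> (#|A| <= max_twins p)%N.
Proof. by move=> pA; apply: (leq_bigmax_cond (F := fun A : {set _} => #|A|)). Qed.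

Lemma max_twins_attained p : {A | twin_pairing p A & #|A| = max_twins p}.
Proof.
have p0 : twin_pairing p set0.
  by apply/twin_pairingP; split=> e; rewrite inE.
by rewrite /max_twins (bigop.bigmax_eq_arg _ p0); case: arg_maxnP => // A pA _; exists A.
Qed.

Lemma order_iso_map (s : seq 'I_n) p (phi : 'I_n -> 'I_n) :
  {in s &, forall x y, (p x < p y)%N = (p (phi x) < p (phi y))%N} ->
  order_iso [seq val (p x) | x <- s] [seq val (p x) | x <- map phi s].
Proof.
move=> H; rewrite /order_iso !size_map eqxx andTb.
case Es: s => [//|x0 s']; rewrite -Es => {s' Es}.
apply/allP => i; rewrite mem_iota add0n /= => iS.
apply/allP => j; rewrite mem_iota add0n /= => jS.
rewrite !(nth_map x0) ?size_map //; apply/eqP; apply: H; exact: mem_nth.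
Qed.

(** The twins occupy the first and the second coordinates of [A]. The partner map [phi] is
    increasing on first coordinates, so it respects the left-to-right order. *)
Lemma twins_of_pairing p A : twin_pairing p A ->
  exists m1 m2 : n.-tuple bool,
    twins (mask m1 (pseq p)) (mask m2 (pseq p)) /\ size (mask m1 (pseq p)) = #|A|.
Proof.
move=> /twin_pairingP[ne cpt].
pose B1 := [set e.1 | e in A]; pose B2 := [set e.2 | e in A].
pose phi i := odflt i (omap snd [pick e in A | e.1 == i]).
have inj1 : {in A &, injective fst}.
  move=> e e' eA e'A E; apply/eqP; apply: contraT => /(cpt _ _ eA e'A).
  by rewrite /compatible E eqxx.
have phiE e : e \in A -> phi e.1 = e.2.
  move=> eA; rewrite /phi; case: pickP => [e' /andP[e'A /eqP /inj1 ->]//|/(_ e)].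
  by rewrite eA eqxx.
pose s1 := [seq i <- enum 'I_n | i \in B1].
pose s2 := [seq i <- enum 'I_n | i \in B2].
have srt (P : pred 'I_n) : sorted (fun i j : 'I_n => (i < j)%N) [seq i <- enum 'I_n | P i].
  apply: sorted_filter; first by move=> y x z; apply: ltn_trans.
  rewrite -[sorted _ _](sorted_map (f := fun i : 'I_n => val i) (e' := ltn)).
  by rewrite val_enum_ord iota_ltn_sorted.
have ms1 i : i \in s1 -> exists2 e, e \in A & i = e.1.
  by rewrite mem_filter => /andP[/imsetP].
(* Both lists are strictly increasing and have the same elements. *)
have s2E : s2 = map phi s1.
  apply: (@irr_sorted_eq _ (fun i j : 'I_n => (i < j)%N)).
  - by move=> y x z; apply: ltn_trans.
  - by move=> x; apply: ltnn.
  - exact: srt.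
  - apply: (@homo_sorted_in _ _ (mem s1) phi (fun i j : 'I_n => (i < j)%N)) (srt _).
      move=> x y /ms1[e eA ->] /ms1[e' e'A ->] lt.
      rewrite !phiE //; have /(cpt _ _ eA e'A) : e != e'.
        by apply: contraTneq lt => ->; rewrite ltnn.
      by case/and5P => _ _ _ _ /andP[/eqP <-].
    exact/allP.
  - move=> i; rewrite mem_filter mem_enum andbT.
    apply/imsetP/mapP => [[e eA ->]|[x /ms1[e eA ->] ->]]; last first.
      by exists e => //; rewrite phiE.
    exists e.1; last by rewrite phiE.
    by rewrite mem_filter mem_enum andbT; apply: imset_f.
have mk (B : {set 'I_n}) : exists m : n.-tuple bool,
    mask m (pseq p) = [seq val (p i) | i <- [seq i <- enum 'I_n | i \in B]].
  have sz : size [seq i \in B | i <- enum 'I_n] == n by rewrite size_map size_enum_ord.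
  by exists (Tuple sz); rewrite /= /pseq -map_mask -filter_mask.
have [m1 E1] := mk B1; have [m2 E2] := mk B2.
exists m1, m2; rewrite E1 E2 -/s1 -/s2 s2E; split.
  apply/andP; split.
    apply: order_iso_map => x y /ms1[e eA ->] /ms1[e' e'A ->]; rewrite !phiE //.
    have [->|nee] := eqVneq e e'; first by rewrite !ltnn.
    by case/and5P: (cpt _ _ eA e'A nee) => _ _ _ _ /andP[_ /eqP].
  apply/allP => _ /mapP[_ /ms1[e eA ->] ->]; rewrite -s2E.
  apply/mapP => -[z]; rewrite mem_filter => /andP[/imsetP[e' e'A ->] _].
  move=> /val_inj /perm_inj E.
  have [Ee|nee] := eqVneq e e'; first by move: (ne _ eA); rewrite E Ee eqxx.
  by move: (cpt _ _ eA e'A nee); rewrite /compatible E eqxx andbF.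
rewrite size_map -(card_in_imset inj1) -/B1 cardE /s1 enumT.
by congr size; apply: eq_filter.
Qed.

Lemma has_long_twins_max p : (n ^ 2 <= (80 * max_twins p) ^ 3)%N -> has_long_twins p.
Proof.
have [A pA <-] := max_twins_attained p => le.
have [m1 [m2 [tw sz]]] := twins_of_pairing p A pA.
by apply/existsP; exists m1; apply/existsP; exists m2; apply/andP; split; rewrite ?sz.
Qed.

(** The conditions are pairwise and read the permutation only at positions occurring in the
    pairs. *)
Lemma twin_pairing_sub p (q : 'S_n) A A' : A' \subset A -> twin_pairing p A ->
  (forall e, e \in A' -> q e.1 = p e.1 /\ q e.2 = p e.2) -> twin_pairing q A'.
Proof.
move=> /subsetP AA /twin_pairingP[ne cpt] pq; apply/twin_pairingP; split.
  by move=> e /AA; apply: ne.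
move=> e e' eA e'A nee; have := cpt _ _ (AA _ eA) (AA _ e'A) nee.
by rewrite /compatible; case: (pq e eA) => -> ->; case: (pq e' e'A) => -> ->.
Qed.

(** Compatible pairs share no position, whichever twin uses it. *)
Lemma twin_pairing_card_at p A (i : 'I_n) : twin_pairing p A ->
  (#|[set e in A | (e.1 == i) || (e.2 == i)]| <= 1)%N.
Proof.
move=> /twin_pairingP[ne cpt]; apply/card_le1_eqP => e e'.
rewrite !inE => /andP[eA ei] /andP[e'A e'i]; apply/eqP; apply: contraT => nee.
move: (cpt _ _ eA e'A); rewrite eq_sym nee => /(_ isT).
rewrite /compatible.
by case/orP: ei => /eqP ->; case/orP: e'i => /eqP ->; rewrite eqxx ?andbF.
Qed.

(* The two transposed values meet at most two pairs of an optimal pairing. *)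
Lemma max_twins_tperm_le p (x y : 'I_n) :
  (max_twins p <= max_twins (p * tperm x y)%g + 2)%N.
Proof.
have [A pA <-] := max_twins_attained p.
pose touch i := [set e in A | (e.1 == i) || (e.2 == i)].
(* The product applies [p] first, so only the positions holding the values [x] and [y] change. *)
pose i := (p^-1)%g x; pose j := (p^-1)%g y.
pose A' := A :\: (touch i :|: touch j).
have gA' : twin_pairing (p * tperm x y)%g A'.
  apply: (twin_pairing_sub p _ A); rewrite ?subsetDl // => e.
  rewrite !inE => /andP[+ eA]; rewrite eA /= !negb_or.
  have E k z : (k != (p^-1)%g z) = (z != p k).
    by rewrite -(inj_eq (@perm_inj _ p)) permKV eq_sym.
  by rewrite !E => /andP[/andP[a b] /andP[c d]]; rewrite !permM !tpermD.
have := card_twin_pairing_le _ _ gA'; rewrite cardsD.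
have le2 : (#|A :&: (touch i :|: touch j)| <= 2)%N.
  apply: leq_trans (subset_leq_card (subsetIr _ _)) _.
  apply: leq_trans (leq_card_setU _ _) _.
  by rewrite -[2]/(1 + 1)%N leq_add // (twin_pairing_card_at p).
lia.
Qed.

Lemma max_twins_lipschitz (R : realDomainType) p (x y : 'I_n) :
  (`|(max_twins (p * tperm x y)%g)%:R - (max_twins p)%:R| <= 2%:R :> R)%R.
Proof.
have h1 := max_twins_tperm_le p x y.
have := max_twins_tperm_le (p * tperm x y)%g x y.
rewrite -mulgA tperm2 mulg1 => h2.
by rewrite ler_distl -natrD lerBlDr -natrD !ler_nat h1 h2.
Qed.
End TwinPairings.

(** * Counting permutations with prescribed values *)

Section Interpolation.
Local Open Scope nat_scope.
Variable T : finType.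
Implicit Types (p q : {perm T}) (s : seq T).

(** Composition with the inverse of [p0] reduces to permutations fixing every entry of [s], that is,
    supported on its complement. *)
Lemma card_perm_map_eq s p0 : uniq s ->
  #|[set p : {perm T} | map p s == map p0 s]| = (#|T| - size s)`!.
Proof.
move=> us; rewrite -(card_imset _ (mulIg p0^-1%g)).
have -> : [set (p * p0^-1)%g | p in [set p : {perm T} | map p s == map p0 s]] =
    [set q | perm_on (~: [set x in s]) q].
  apply/setP => q; rewrite inE; apply/imsetP/subsetP => [[p + ->] x|qS].
    rewrite !inE => /eqP/eq_in_map E; apply: contra => xs.
    by rewrite permM E // permK.
  exists (q * p0)%g; last by rewrite mulgK.
  rewrite inE; apply/eqP/eq_in_map => x xs; rewrite permM; congr (p0 _).
  by apply/eqP; apply: contraLR xs => /qS; rewrite !inE.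
rewrite cardsE card_perm cardsCs setCK cardsE; congr (_ - _)`!.
exact/card_uniqP.
Qed.

(** Only an inequality, since [t] may be unattainable, for instance through repeated entries. *)
Lemma card_perm_map_le s (t : seq T) : uniq s ->
  (#|[set p : {perm T} | map p s == t]| <= (#|T| - size s)`!)%N.
Proof.
move=> us; case: (set_0Vmem [set p : {perm T} | map p s == t]) => [->|[p0]].
  by rewrite cards0.
by rewrite inE => /eqP <-; rewrite card_perm_map_eq.
Qed.

Lemma card_perm_pair (x y x' y' : T) : x != y -> x' != y' ->
  #|[set p : {perm T} | (p x == x') && (p y == y')]| = (#|T| - 2)`!.
Proof.
move=> xy xy'.
(* The first transposition sends [x] to [x']; the second corrects the image of [y] without moving
   [x']. *)
pose p0 := (tperm x x' * tperm (tperm x x' y) y')%g.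
have p0x : p0 x = x'.
  rewrite permM tpermL tpermD // 1?eq_sym //.
  by apply: contraNneq xy => E; apply/eqP; apply: (@perm_inj _ (tperm x x')); rewrite tpermL.
have p0y : p0 y = y' by rewrite permM tpermL.
have := @card_perm_map_eq [:: x; y] p0; rewrite /= inE xy => /(_ isT) <-.
by apply: eq_card => p; rewrite !inE p0x p0y !eqseq_cons andbT.
Qed.

(** Double counting over the tuple [t] and its image [u]. *)
Lemma sum_card_double (I : finType) (act : {perm T} -> I -> I) (P Q : pred I) :
  (\sum_(p : {perm T}) #|[set t | P t && Q (act p t)]| =
   \sum_(t | P t) \sum_(u | Q u) #|[set p | act p t == u]|)%N.
Proof.
transitivity (\sum_(p : {perm T}) \sum_(t | P t) \sum_(u | Q u) (act p t == u))%N.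
  apply: eq_bigr => p _; rewrite -sum1dep_card big_mkcondr; apply: eq_bigr => t _.
  case: ifP => [Qt|nQ].
    rewrite (bigD1 (act p t)) //= eqxx big1 // => u /andP[_].
    by rewrite eq_sym => /negbTE ->.
  by rewrite big1 // => u Qu; case: eqP => // E; rewrite E Qu in nQ.
rewrite exchange_big; apply: eq_bigr => t _; rewrite exchange_big.
by apply: eq_bigr => u _; rewrite -sum1dep_card [RHS]big_mkcond; apply: eq_bigr => p _; case: eqP.
Qed.

(** Reading tuples as sequences through [x] lets one statement serve triples and quadruples. *)
Lemma sum_card_le (I : finType) (x : I -> seq T) (act : {perm T} -> I -> I)
    (P Q : pred I) k :
  (forall p t, x (act p t) = map p (x t)) ->
  (forall t, P t -> uniq (x t) && (size (x t) == k)) ->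
  (\sum_(p : {perm T}) #|[set t | P t && Q (act p t)]| <= #|P| * #|Q| * (#|T| - k)`!)%N.
Proof.
move=> xact Pu; rewrite sum_card_double.
rewrite -mulnA -!sum_nat_const; apply: leq_sum => t Pt; apply: leq_sum => u _.
have /andP[ut /eqP <-] := Pu t Pt.
apply: leq_trans (card_perm_map_le _ (x u) ut).
apply: subset_leq_card; apply/subsetP => p; rewrite !inE => /eqP <-.
by rewrite xact.
Qed.

Lemma sum_card_pairs (P Q : pred (T * T)) :
  (forall e, P e -> e.1 != e.2) -> (forall e, Q e -> e.1 != e.2) ->
  (\sum_(p : {perm T}) #|[set e | P e && Q (p e.1, p e.2)]| = #|P| * #|Q| * (#|T| - 2)`!)%N.
Proof.
move=> Pu Qu; rewrite (sum_card_double _ (fun p e => (p e.1, p e.2))).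
rewrite -mulnA -!sum_nat_const; apply: eq_bigr => t Pt; apply: eq_bigr => u /Qu uu.
exact: card_perm_pair (Pu _ Pt) uu.
Qed.
End Interpolation.

(** * Pairs of points in a common cell *)

Section Blocks.
Local Open Scope nat_scope.
Variables (n b : nat).
Hypothesis b_gt0 : (0 < b)%N.
Implicit Types (p : 'S_n) (i j k : 'I_n).

(** Positions and values are cut by the same blocks; the last one may be incomplete. *)
Definition same_block i j : bool := (i %/ b == j %/ b)%N.

Lemma same_block_sym : symmetric same_block.
Proof. by move=> i j; rewrite /same_block eq_sym. Qed.

Lemma same_block_trans : transitive same_block.
Proof. by move=> j i k; rewrite /same_block => /eqP ->. Qed.

Lemma card_same_block_le (I : finType) (P : pred I) (g : I -> 'I_n) :
  (#|[pred u : I * 'I_n | P u.1 && same_block (g u.1) u.2]| <= #|P| * b)%N.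
Proof.
have -> : #|[pred u : I * 'I_n | P u.1 && same_block (g u.1) u.2]| =
    (\sum_(t | P t) #|[pred j | same_block (g t) j]|)%N.
  rewrite -sum1_card (eq_bigr (fun t => \sum_(j | same_block (g t) j) 1)%N); last first.
    by move=> t _; rewrite sum1_card.
  by rewrite pair_big_dep.
rewrite -sum_nat_const; apply: leq_sum => t _.
rewrite -[leqRHS]card_ord.
(* Residues modulo [b] are injective on a block. *)
pose h j : 'I_b := Ordinal (ltn_pmod j b_gt0).
rewrite -(card_in_imset (f := h)) ?max_card // => j k.
rewrite !inE /same_block => /eqP Ej /eqP Ek [E]; apply: val_inj => /=.
by rewrite (divn_eq j b) (divn_eq k b) -Ej -Ek E.
Qed.

Lemma card_free (I : finType) (P : pred I) :
  #|[pred u : I * 'I_n | P u.1]| = (#|P| * n)%N.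
Proof.
rewrite -[in RHS](card_ord n) -cardX; apply: eq_card => -[t i].
by rewrite !inE andbT.
Qed.

(** Values range over pairs in both orders, positions only over increasing pairs, so that each
    unordered pair of points is counted once. *)
Definition block_pair : pred ('I_n * 'I_n) := fun e => (e.1 != e.2) && same_block e.1 e.2.
Definition block_lpair : pred ('I_n * 'I_n) := fun e => (e.1 < e.2)%N && same_block e.1 e.2.
Definition block_triple : pred ('I_n * 'I_n * 'I_n) := fun t =>
  same_block t.1.1 t.1.2 && same_block t.1.1 t.2.
Definition block_2pairs : pred ('I_n * 'I_n * 'I_n * 'I_n) := fun t =>
  same_block t.1.1.1 t.1.1.2 && same_block t.1.2 t.2.
Definition block_quad : pred ('I_n * 'I_n * 'I_n * 'I_n) := fun t =>
  (same_block t.1.1.1 t.1.1.2 && same_block t.1.1.1 t.1.2) && same_block t.1.2 t.2.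

Lemma card_triple : (#|block_triple| <= n * b ^ 2)%N.
Proof.
apply: leq_trans (card_same_block_le _ (fun e => same_block e.1 e.2) (fun e => e.1)) _.
rewrite expnS expn1 mulnA leq_mul2r; apply/orP; right.
apply: leq_trans (card_same_block_le _ xpredT id) _.
by rewrite card_ord.
Qed.

Lemma card_2pairs : (#|block_2pairs| <= (n * b) ^ 2)%N.
Proof.
pose two (u : 'I_n * 'I_n * 'I_n) := same_block u.1.1 u.1.2.
apply: leq_trans (card_same_block_le _ two (fun u => u.2)) _.
rewrite (_ : #|two| = #|[pred e : 'I_n * 'I_n | same_block e.1 e.2]| * n)%N; last first.
  by rewrite -card_free; apply: eq_card.
rewrite expnS expn1 mulnA leq_mul2r; apply/orP; right.
rewrite leq_mul2r; apply/orP; right.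
apply: leq_trans (card_same_block_le _ xpredT id) _.
by rewrite card_ord.
Qed.

Lemma card_quad : (#|block_quad| <= n * b ^ 3)%N.
Proof.
apply: leq_trans (card_same_block_le _ block_triple (fun u => u.2)) _.
by rewrite expnSr mulnA leq_mul2r card_triple orbT.
Qed.

(** Only complete blocks are used; [a * b + u] is the point at offset [u] in block [a]. *)
Lemma card_block_pair : (n %/ b * (b * b.-1) <= #|block_pair|)%N.
Proof.
have pos (a : 'I_(n %/ b)) (u : 'I_b) : (a * b + u < n)%N.
  have := ltn_ord u; have : (a.+1 * b <= n)%N.
    by apply: leq_trans (leq_trunc_div n b); rewrite leq_mul2r ltn_ord orbT.
  by rewrite mulSn; lia.
pose D : {set 'I_(n %/ b) * ('I_b * 'I_b)} := [set t | t.2.1 != t.2.2].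
pose h (t : 'I_(n %/ b) * ('I_b * 'I_b)) :=
  (Ordinal (pos t.1 t.2.1), Ordinal (pos t.1 t.2.2)).
have hdiv (a : 'I_(n %/ b)) (u : 'I_b) : ((a * b + u) %/ b = a)%N.
  by rewrite divnMDl // (divn_small (ltn_ord u)) addn0.
have hmod (a : 'I_(n %/ b)) (u : 'I_b) : ((a * b + u) %% b = u)%N.
  by rewrite modnMDl (modn_small (ltn_ord u)).
have hinj : injective h.
  move=> [a [u v]] [a' [u' v']] [E1 E2].
  have Ea : a = a' by apply: val_inj; rewrite /= -(hdiv a u) E1 hdiv.
  have Eu : u = u' by apply: val_inj; rewrite /= -(hmod a u) E1 hmod.
  have Ev : v = v' by apply: val_inj; rewrite /= -(hmod a v) E2 hmod.
  by rewrite Ea Eu Ev.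
have cD : #|D| = (n %/ b * (b * b.-1))%N.
  have -> : D = setX setT [set e : 'I_b * 'I_b | e.1 != e.2].
    by apply/setP => t; rewrite !inE.
  rewrite cardsX cardsT card_ord; congr (_ * _)%N.
  rewrite -sum1dep_card -(pair_big_dep xpredT (fun u v : 'I_b => u != v) (fun _ _ => 1%N)) /=.
  rewrite (eq_bigr (fun _ => b.-1)) ?sum_nat_const ?card_ord // => u _.
  rewrite sum1_card -[in RHS](card_ord b) -(cardC1 u).
  by apply: eq_card => v; rewrite !inE eq_sym.
rewrite -cD -(card_imset _ hinj); apply: subset_leq_card; apply/subsetP.
move=> _ /imsetP[[a [u v]] + ->]; rewrite inE /= => uv.
rewrite unfold_in /block_pair /same_block /= !hdiv eqxx andbT.
by apply: contraNneq uv => -[E]; apply/eqP/val_inj; rewrite /= -(hmod a u) E hmod.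
Qed.

Lemma card_block_lpair : #|block_pair| = (2 * #|block_lpair|)%N.
Proof.
pose sw (e : 'I_n * 'I_n) := (e.2, e.1).
have swK : involutive sw by case.
rewrite mul2n -addnn -[X in _ = (X + _)%N](card_imset _ (inv_inj swK)).
rewrite -(cardID (fun e : 'I_n * 'I_n => (e.1 < e.2)%N) block_pair) addnC; congr (_ + _)%N.
  apply: eq_card => e; rewrite [LHS]inE; apply/andP/imsetP; rewrite !unfold_in.
    move=> [nlt /andP[ne sm]]; exists (sw e); rewrite ?swK // unfold_in /block_lpair /=.
    rewrite same_block_sym sm andbT ltn_neqAle leqNgt nlt andbT.
    by apply: contraNneq ne => E; apply/eqP/val_inj.
  move=> [e' + ->]; rewrite unfold_in => /andP[lt sm] /=.
  rewrite -leqNgt ltnW // /block_pair /= same_block_sym sm andbT.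
  by split=> //; apply: contraTneq lt => ->; rewrite ltnn.
apply: eq_card => e; rewrite !inE !unfold_in /block_pair /block_lpair.
case: (ltnP e.1 e.2) => lt; rewrite ?andbF // andbT.
by have -> : e.1 != e.2 by apply: contraTneq lt => ->; rewrite ltnn.
Qed.

(** Blocks are intervals. Hence points in distinct blocks can be replaced by others of their blocks
    without changing the comparison. *)
Lemma ltn_block i j : ~~ same_block i j -> (i < j)%N = (i %/ b < j %/ b)%N.
Proof.
rewrite /same_block neq_ltn => /orP[] lt; rewrite ?lt ltnNge.
  by apply: contraTN lt; rewrite -leqNgt; apply: leq_div2r.
rewrite [X in _ = X]ltnNge (ltnW lt); apply/negbTE; rewrite negbK.
by apply: contraTT lt; rewrite -leqNgt -ltnNge => /ltnW; apply: leq_div2r.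
Qed.

(* A pair i < j is a hit when its positions share a block and its values share
   a block.  Removing the pairs whose cell contains a third point (bad3), and
   those having another hit in the same row (bad_row) or column (bad_col) of
   cells, leaves a twin pairing. *)
Definition hits p := [set e | block_lpair e && block_pair (p e.1, p e.2)].
Definition act3 p (t : 'I_n * 'I_n * 'I_n) := (p t.1.1, p t.1.2, p t.2).
Definition act4 p (t : 'I_n * 'I_n * 'I_n * 'I_n) := (p t.1.1.1, p t.1.1.2, p t.1.2, p t.2).
Definition seq3 (t : 'I_n * 'I_n * 'I_n) := [:: t.1.1; t.1.2; t.2].
Definition seq4 (t : 'I_n * 'I_n * 'I_n * 'I_n) := [:: t.1.1.1; t.1.1.2; t.1.2; t.2].

Definition bad3 p := [set t | (uniq (seq3 t) && block_triple t) && block_triple (act3 p t)].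
Definition bad_row p := [set t | (uniq (seq4 t) && block_quad t) && block_2pairs (act4 p t)].
Definition bad_col p := [set t | (uniq (seq4 t) && block_2pairs t) && block_quad (act4 p t)].

Lemma hits_le p :
  (#|hits p| <= max_twins n p + #|bad3 p| + #|bad_row p| + #|bad_col p|)%N.
Proof.
(* Each bad tuple deletes only its first pair, so [B] has at most as many elements as there are bad
   tuples. *)
pose B := fst @: bad3 p :|: (fun t => t.1.1) @: bad_row p :|: (fun t => t.1.1) @: bad_col p.
pose A := hits p :\: B.
have cB : (#|B| <= #|bad3 p| + #|bad_row p| + #|bad_col p|)%N.
  apply: leq_trans (leq_card_setU _ _) _; apply: leq_add; last exact: leq_imset_card.
  by apply: leq_trans (leq_card_setU _ _) _; apply: leq_add; apply: leq_imset_card.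
have gA : twin_pairing n p A.
  apply/twin_pairingP; split=> [e|].
    by rewrite !inE => /andP[_ /andP[/andP[lt _] _]]; apply: contraTneq lt => ->; rewrite ltnn.
  move=> [i j] [i' j'] eA e'A; apply: contraNT => incompatible.
  move: eA e'A; rewrite !inE /= => /andP[nB /andP[/andP[lt sm] /andP[_ sv]]].
  move=> /andP[_ /andP[/andP[lt' sm'] /andP[_ sv']]]; rewrite /= in lt lt' sm sm' sv sv'.
  move: nB; rewrite !negb_or => /andP[/andP[n3 nr] nc].
  have neq : i != j by apply: contraTneq lt => ->; rewrite ltnn.
  have neq' : i' != j' by apply: contraTneq lt' => ->; rewrite ltnn.
  have third k : same_block i k -> same_block (p i) (p k) -> (k == i) || (k == j).
    move=> ik vik; apply: contraNT n3; rewrite negb_or => /andP[ki kj].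
    apply/imsetP; exists (i, j, k) => //.
    rewrite !inE /block_triple /= !inE negb_or neq sm sv ik vik.
    by rewrite eq_sym ki eq_sym kj.
  (* A second hit in the cell must use the same two points, and both pairs are increasing. *)
  have cell : same_block i i' -> same_block (p i) (p i') -> (i, j) == (i', j').
    move=> ii' vii'.
    have := third i' ii' vii'.
    have := third j' (same_block_trans _ _ _ ii' sm') (same_block_trans _ _ _ vii' sv').
    case/orP=> /eqP E1; case/orP=> /eqP E2; subst; rewrite ?eqxx // in neq' lt lt' *.
    by move: (ltn_trans lt lt'); rewrite ltnn.
  have [iicase|sii] := boolP (same_block i i' && same_block (p i) (p i')).
    by case/andP: iicase; apply: cell.
  (* The two hits lie in different cells, so no position is common to them. *)
  have distinct : uniq [:: i; j; i'; j'].
    rewrite /= !inE !negb_or neq neq' /= !andbT.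
    have aux x y : same_block i x -> same_block (p i) (p x) ->
        same_block i' y -> same_block (p i') (p y) -> x != y.
      move=> ix vix iy viy; apply: contraNneq sii => E.
      rewrite (same_block_trans _ _ _ ix) ?(same_block_trans _ _ _ vix) // same_block_sym E //.
    have rf x : same_block x x by rewrite /same_block.
    by rewrite !aux.
  (* A common block of positions would put the quadruple in [bad_row]; a common block of values,
     below, in [bad_col]. *)
  have nsm : ~~ same_block i i'.
    apply: contra nr => ii'; apply/imsetP; exists (i, j, i', j') => //.
    rewrite inE [uniq _]distinct /block_quad /block_2pairs /=.
    by rewrite sm sm' ii' sv sv'.
  have nsv : ~~ same_block (p i) (p i').
    apply: contra nc => ii'; apply/imsetP; exists (i, j, i', j') => //.
    rewrite inE [uniq _]distinct /block_quad /block_2pairs /=.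
    by rewrite sm sm' ii' sv sv'.
  case/negP: incompatible; move: distinct; rewrite /= !inE !negb_or.
  move=> /and3P[/and3P[_ d1 d2] /andP[d3 d4] _]; rewrite /compatible /= d1 d2 d3 d4 /=.
  have tr (x y x' y' : 'I_n) : same_block x y -> same_block x' y' -> ~~ same_block x x' ->
      (x < x')%N == (y < y')%N.
    move=> xy xy' xx'; rewrite !ltn_block //; last first.
      apply: contra xx' => yy'; rewrite (same_block_trans _ _ _ xy) //.
      rewrite (same_block_trans _ _ _ yy') //.
      by rewrite same_block_sym.
    by rewrite (eqP xy) (eqP xy').
  by rewrite !tr.
rewrite -(cardsID B (hits p)) addnC -!addnA leq_add ?card_twin_pairing_le // addnA.
exact: leq_trans (subset_leq_card (subsetIr _ _)) cB.
Qed.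

(** Sum [hits_le] over all permutations, with an exact count of hits and upper bounds for the bad
    tuples. The factor 4 absorbs the 1/2 relating increasing to ordered pairs; rows and columns give
    equal bounds. *)
Lemma sum_max_twins :
  (2 * (n %/ b * (b * b.-1)) ^ 2 * (n - 2)`! <=
   4 * (\sum_(p : 'S_n) max_twins n p +
     (n * b ^ 2) ^ 2 * (n - 3)`! + 2 * (n * b ^ 3 * (n * b) ^ 2 * (n - 4)`!)))%N.
Proof.
have sh : (\sum_(p : 'S_n) #|hits p| = #|block_lpair| * #|block_pair| * (n - 2)`!)%N.
  rewrite (sum_card_pairs _ block_lpair block_pair) ?card_ord // => e /andP[//].
  by move=> lt _; apply: contraTneq lt => ->; rewrite ltnn.
have s3 : (\sum_(p : 'S_n) #|bad3 p| <= (n * b ^ 2) ^ 2 * (n - 3)`!)%N.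
  have := sum_card_le _ _ seq3 act3 (fun t => uniq (seq3 t) && block_triple t) block_triple 3.
  rewrite card_ord => /(_ _ _)/leq_trans; apply => //.
    by move=> t /andP[-> _].
  rewrite leq_mul2r; apply/orP; right; rewrite expnS expn1; apply: leq_mul; last exact: card_triple.
  apply: leq_trans card_triple; apply: subset_leq_card; apply/subsetP => t.
  by rewrite !unfold_in => /andP[].
have sr : (\sum_(p : 'S_n) #|bad_row p| <= (n * b ^ 3) * (n * b) ^ 2 * (n - 4)`!)%N.
  have := sum_card_le _ _ seq4 act4 (fun t => uniq (seq4 t) && block_quad t) block_2pairs 4.
  rewrite card_ord => /(_ _ _)/leq_trans; apply => //.
    by move=> t /andP[-> _].
  rewrite leq_mul2r; apply/orP; right; apply: leq_mul; last exact: card_2pairs.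
  apply: leq_trans card_quad; apply: subset_leq_card; apply/subsetP => t.
  by rewrite !unfold_in => /andP[].
have sc : (\sum_(p : 'S_n) #|bad_col p| <= (n * b ^ 3) * (n * b) ^ 2 * (n - 4)`!)%N.
  have := sum_card_le _ _ seq4 act4 (fun t => uniq (seq4 t) && block_2pairs t) block_quad 4.
  rewrite card_ord => /(_ _ _)/leq_trans; apply => //.
    by move=> t /andP[-> _].
  rewrite leq_mul2r; apply/orP; right; rewrite mulnC; apply: leq_mul; first exact: card_quad.
  apply: leq_trans card_2pairs; apply: subset_leq_card; apply/subsetP => t.
  by rewrite !unfold_in => /andP[].
have tot : (\sum_(p : 'S_n) #|hits p| <= \sum_(p : 'S_n) max_twins n p +
   \sum_(p : 'S_n) #|bad3 p| + \sum_(p : 'S_n) #|bad_row p| + \sum_(p : 'S_n) #|bad_col p|)%N.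
  by rewrite -!big_split /=; apply: leq_sum => p _; apply: hits_le.
apply: (@leq_trans (4 * \sum_(p : 'S_n) #|hits p|)); last first.
  rewrite leq_mul2l /=; apply: (leq_trans tot).
  by rewrite -!addnA leq_add2l mul2n -addnn leq_add // leq_add.
rewrite sh.
have -> : (4 * (#|block_lpair| * #|block_pair| * (n - 2)`!) = 2 * #|block_pair| ^ 2 * (n - 2)`!)%N.
  by rewrite expnS expn1 {2}card_block_lpair; ring.
by rewrite leq_mul2r leq_mul2l /= leq_exp2r // card_block_pair orbT.
Qed.
End Blocks.

(** * Concentration *)

(** Since [8 * b ^+ 3 <= n], the first two terms on the left are at most 1/800 and 1/4 of
    [n ^+ 4 * b ^+ 2]. The six factors on the right lose at most one percent each, and
    [(99 / 100) ^+ 6 / 2] exceeds 1/800 + 1/4 + 1/5. *)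
Lemma first_moment_arith (R : realFieldType) (n b : R) :
  100 <= b -> 8 * b ^+ 3 <= n ->
  n ^+ 3 * b ^+ 4 + 2 * (n ^+ 3 * b ^+ 5) + n ^+ 4 * b ^+ 2 / 5 <=
  ((n - b) * (b - 1)) ^+ 2 * (n - 2) * (n - 3) / 2.
Proof.
move=> b100 nb.
have b0 : 0 < b by lra.
have n0 : 0 < n by apply: lt_le_trans nb; rewrite mulr_gt0 ?exprn_gt0.
have b3 : 100 * b <= b ^+ 3.
  by rewrite exprSr ler_pM2r //; nra.
have h1 : 99 / 100 * n <= n - b by lra.
have h2 : 99 / 100 * b <= b - 1 by lra.
have h3 : 99 / 100 * n <= n - 2 by lra.
have h4 : 99 / 100 * n <= n - 3 by lra.
have main : (99 / 100 * n * (99 / 100 * b)) ^+ 2 * (99 / 100 * n) * (99 / 100 * n) <=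
    ((n - b) * (b - 1)) ^+ 2 * (n - 2) * (n - 3).
  have p1 : 0 <= 99 / 100 * n by rewrite mulr_ge0 ?divr_ge0 // ltW.
  have p2 : 0 <= 99 / 100 * b by rewrite mulr_ge0 ?divr_ge0 // ltW.
  apply: ler_pM => //; first by rewrite mulr_ge0 ?sqr_ge0.
  apply: ler_pM => //; first exact: sqr_ge0.
  have p3 := mulr_ge0 p1 p2.
  have p4 := ler_pM p1 p2 h1 h2.
  by rewrite lerXn2r ?nnegrE // (le_trans p3).
have c1 : n ^+ 3 * b ^+ 5 <= n ^+ 4 * b ^+ 2 / 8.
  rewrite [leLHS](_ : _ = n ^+ 3 * b ^+ 2 * (8 * b ^+ 3) / 8); last by field.
  rewrite [leRHS](_ : _ = n ^+ 3 * b ^+ 2 * n / 8); last by field.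
  by rewrite ler_pM2r ?invr_gt0 // ler_pM2l ?mulr_gt0 ?exprn_gt0.
have c2 : 100 * (n ^+ 3 * b ^+ 4) <= n ^+ 3 * b ^+ 5.
  rewrite [leRHS](_ : _ = b * (n ^+ 3 * b ^+ 4)); last by ring.
  by rewrite ler_pM2r // mulr_gt0 ?exprn_gt0.
have c3 : 0 <= n ^+ 4 * b ^+ 2 by rewrite mulr_ge0 ?exprn_ge0 // ltW.
move: main; rewrite [leLHS](_ : _ = (99 / 100) ^+ 6 * (n ^+ 4 * b ^+ 2)); last by ring.
by move: c1 c2 c3; clear; lra.
Qed.

(** Here [d] stands for the factorial of [n - 4], [s] for the sum of [max_twins], and [q] for the
    number of ordered pairs in complete blocks. *)
Lemma total_twins_arith (R : realFieldType) (n b d q s : R) :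
  100 <= b -> 8 * b ^+ 3 <= n -> 4 <= n -> 0 < d -> b <= n -> (n - b) * (b - 1) <= q ->
  2 * q ^+ 2 * ((n - 2) * ((n - 3) * d)) <=
    4 * (s + (n * b ^+ 2) ^+ 2 * ((n - 3) * d) + 2 * (n * b ^+ 3 * (n * b) ^+ 2 * d)) ->
  n * ((n - 1) * ((n - 2) * ((n - 3) * d))) * (b ^+ 2 / 5) <= s.
Proof.
move=> b100 nb n4 d0 bn qge key.
have := first_moment_arith _ _ _ b100 nb.
have b0 : 0 <= b by apply: le_trans b100.
have n0 : 0 <= n by apply: le_trans n4.
have n2 : 0 <= n - 2 by rewrite subr_ge0 (le_trans _ n4) ?ler_nat.
have n3 : 0 <= n - 3 by rewrite subr_ge0 (le_trans _ n4) ?ler_nat.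
have nb0 : 0 <= (n - b) * (b - 1).
  by rewrite mulr_ge0 ?subr_ge0 // (le_trans _ b100) ?ler1n.
have qq : ((n - b) * (b - 1)) ^+ 2 * (n - 2) * (n - 3) <= q ^+ 2 * (n - 2) * (n - 3).
  by rewrite ler_wpM2r // ler_wpM2r // lerXn2r ?nnegrE // (le_trans nb0).
have a1 : n ^+ 2 * b ^+ 4 * (n - 3) <= n ^+ 3 * b ^+ 4.
  rewrite [leRHS](_ : _ = n ^+ 2 * b ^+ 4 * n); last by ring.
  by rewrite ler_wpM2l ?mulr_ge0 ?exprn_ge0 // gerBl.
have a2 : n * ((n - 1) * ((n - 2) * (n - 3))) * b ^+ 2 <= n ^+ 4 * b ^+ 2.
  have n1 : 0 <= n - 1 by rewrite subr_ge0 (le_trans _ n4) ?ler1n.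
  rewrite ler_wpM2r ?exprn_ge0 // !exprS expr0 mulr1 ler_wpM2l //.
  by do 2 (apply: ler_pM; rewrite ?mulr_ge0 ?gerBl //).
rewrite -(ler_pM2r d0) in qq; rewrite -(ler_pM2r d0) in a1; rewrite -(ler_pM2r d0) in a2.
rewrite -(ler_pM2r d0); move: qq a1 a2 key; clear; lra.
Qed.

Lemma mean_max_twins_ge (n b : nat) : (100 <= b)%N -> (8 * b ^ 3 <= n)%N ->
  (b ^ 2)%:R / 5 <= (n`!%:R)^-1 * \sum_(p : 'S_n) (max_twins n p)%:R :> rat.
Proof.
move=> b100 nb.
have b0 : (0 < b)%N by lia.
have n4 : (4 <= n)%N.
  apply: leq_trans nb; have : (0 < b ^ 3)%N by rewrite expn_gt0 b0.
  by lia.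
have bn : (b <= n)%N by apply: leq_trans nb; rewrite expnS; nia.
rewrite ler_pdivlMl ?ltr0n ?fact_gt0 // -natr_sum.
(* Complete blocks miss fewer than [b] points. *)
have [q qge] : exists2 q, ((n - b) * (b - 1) <= q)%N &
    (2 * q ^ 2 * (n - 2)`! <= 4 * (\sum_(p : 'S_n) max_twins n p +
      (n * b ^ 2) ^ 2 * (n - 3)`! + 2 * (n * b ^ 3 * (n * b) ^ 2 * (n - 4)`!)))%N.
  exists (n %/ b * (b * b.-1))%N; last exact: sum_max_twins.
  rewrite mulnA subn1 leq_mul2r; apply/orP; right.
  by rewrite leq_subLR addnC {1}(divn_eq n b) leq_add2l ltnW // ltn_pmod.
move: (\sum_(p : 'S_n) max_twins n p)%N => S.
pose N : rat := n%:R; pose B : rat := b%:R; pose D : rat := (n - 4)`!%:R.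
have factN k : (k < n)%N -> (n - k)`!%:R = (N - k%:R) * (n - k.+1)`!%:R :> rat.
  by move=> kn; rewrite -natrB 1?ltnW // -natrM -{1}(subnSK kn) factS subnSK.
have D0 : 0 < D by rewrite ltr0n fact_gt0.
have e3 : (n - 3)`!%:R = (N - 3) * D by apply: factN.
have e2 : (n - 2)`!%:R = (N - 2) * ((N - 3) * D) by rewrite -e3; apply: factN; lia.
have e0 : n`!%:R = N * ((N - 1) * ((N - 2) * ((N - 3) * D))).
  have n0 : (0 < n)%N by lia.
  have n1 : (1 < n)%N by lia.
  by have := factN 0%N n0; rewrite subn0 subr0 (factN 1%N n1) e2.
have qge' : (N - B) * (B - 1) <= q%:R.
  by rewrite -natrB // -(natrB _ b0) -natrM ler_nat.
rewrite -(ler_nat rat) !(natrM, natrD, natrX) e2 e3 e0 -/N -/B -/D => key.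
have B100 : 100 <= B by rewrite (ler_nat _ 100).
have NB : 8 * B ^+ 3 <= N by rewrite -natrX -natrM ler_nat.
have BN : B <= N by rewrite ler_nat.
have N4 : 4 <= N by rewrite (ler_nat _ 4).
exact: (total_twins_arith _ N B D q%:R S%:R).
Qed.

(** * Chebyshev's inequality and passage to the limit *)

Lemma cube_block_size (n : nat) : exists b, (8 * b ^ 3 <= n < 8 * b.+1 ^ 3)%N.
Proof.
have ex0 : exists b, (8 * b ^ 3 <= n)%N by exists 0%N.
have bound b : (8 * b ^ 3 <= n -> b <= n)%N.
  apply: leq_trans; case: b => // b; apply: leq_trans (leq_pmull _ _) => //.
  by rewrite -[leqLHS]expn1 leq_pexp2l.
case: (ex_maxnP ex0 bound) => b le max; exists b; rewrite le ltnNge.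
by apply: contraTN isT => /max; rewrite ltnn.
Qed.

(** The mean is at least [b ^ 2 / 5], so each permutation counted deviates by at least [b ^ 2 / 10];
    400 is the squared Lipschitz constant 4 times 100. *)
Lemma card_few_twins (n b : nat) : (100 <= b)%N -> (8 * b ^ 3 <= n)%N ->
  #|[set p : 'S_n | 10 * max_twins n p < b ^ 2]%N|%:R * b%:R ^+ 4
    <= 400 * n%:R * n`!%:R :> rat.
Proof.
move=> b100 nb; set m := [set p | _].
have := @perm_variance rat 'I_n (fun p => (max_twins n p)%:R) 2 (max_twins_lipschitz n rat).
have := mean_max_twins_ge n b b100 nb.
rewrite card_ord; set mean := (_^-1 * _) => meanB var.
have low : \sum_(p in m) (b%:R ^+ 2 / 10) ^+ 2 <=
    \sum_(p : 'S_n) ((max_twins n p)%:R - mean) ^+ 2.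
  rewrite [leRHS](bigID (mem m)) /= -[leLHS]addr0; apply: lerD; last first.
    by apply: sumr_ge0 => p _; apply: sqr_ge0.
  apply: ler_sum => p; rewrite inE -(ltr_nat rat) natrM natrX => few.
  rewrite -[leRHS]sqrrN lerXn2r ?nnegrE ?divr_ge0 ?exprn_ge0 //.
    move: meanB few; rewrite natrX; set B := b%:R ^+ 2.
    have : 0 <= B by rewrite sqr_ge0.
    lra.
  move: meanB few; rewrite natrX; set B := b%:R ^+ 2.
  lra.
have := le_trans low var; rewrite sumr_const -[_ *+ #|m|]mulr_natl natrM.
move: (#|m|%:R) (n%:R) (n`!%:R) (b%:R) => c N f B; clear; lra.
Qed.

(** The constant comes from [400 * 8 * (101 / 100) ^+ 3 <= 3300]. *)
Lemma failure_ratio_le (R : realFieldType) (c n f b : R) : 0 < f -> 100 <= b ->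
  c * b ^+ 4 <= 400 * n * f -> n <= 8 * (b + 1) ^+ 3 -> c / f <= 3300 / b.
Proof.
move=> f0 b100 cb nb.
have b0 : 0 < b by apply: lt_le_trans b100.
have b1 : b + 1 <= 101 / 100 * b by move: b100; clear; lra.
have {}nb : 400 * n <= 3300 * b ^+ 3.
  have : (b + 1) ^+ 3 <= (101 / 100 * b) ^+ 3.
    by rewrite lerXn2r ?nnegrE ?addr_ge0 // ?(ltW b0) // (le_trans _ b1) ?addr_ge0 ?(ltW b0).
  have : 0 <= b ^+ 3 by rewrite exprn_ge0 ?(ltW b0).
  by move: nb; rewrite exprMn; move: (b ^+ 3) => x; clear; lra.
rewrite (ler_pdivrMr _ _ f0) mulrAC (ler_pdivlMr _ _ b0).
rewrite -(ler_pM2r (exprn_gt0 3 b0)) -mulrA -exprS.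
by apply: (le_trans cb); rewrite [leRHS]mulrAC (ler_pM2r f0).
Qed.

Lemma prob_long_twins_ge (n b : nat) : (100 <= b)%N -> (8 * b ^ 3 <= n < 8 * b.+1 ^ 3)%N ->
  `|prob_long_twins n - 1| <= 3300 / b%:R.
Proof.
move=> b100 /andP[nb nb1].
pose L := [set p : 'S_n | has_long_twins p].
pose few := [set p : 'S_n | 10 * max_twins n p < b ^ 2]%N.
have sub : ~: L \subset few.
  apply/subsetP => p; rewrite !inE; apply: contraNltn => many.
  apply: has_long_twins_max.
  (* This threshold suffices because [n ^ 2] is below [(8 * b.+1 ^ 3) ^ 2], which equals
     [(4 * b.+1 ^ 2) ^ 3]. *)
  have sq : (4 * b.+1 ^ 2 <= 80 * max_twins n p)%N.
    apply: (@leq_trans (8 * b ^ 2)); last by move: many; lia.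
    nia.
  have : ((4 * b.+1 ^ 2) ^ 3 <= (80 * max_twins n p) ^ 3)%N by rewrite leq_exp2r.
  apply: leq_trans; apply: (@leq_trans ((8 * b.+1 ^ 3) ^ 2)).
    by rewrite leq_exp2r // ltnW.
  by rewrite (_ : (8 * b.+1 ^ 3) ^ 2 = (4 * b.+1 ^ 2) ^ 3)%N; last ring.
have F0 : 0 < n`!%:R :> rat by rewrite ltr0n fact_gt0.
have cLC : (#|L| + #|~: L|)%N = n`! by rewrite cardsC card_Sn.
have -> : prob_long_twins n - 1 = - (#|~: L|%:R / n`!%:R).
  rewrite /prob_long_twins -/L card_Sn -[in X in X - 1]cLC.
  have : (#|L| + #|~: L|)%:R != 0 :> rat by rewrite cLC gt_eqF.
  by rewrite -[in RHS]cLC natrD => nz; field.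
have r0 : 0 <= #|~: L|%:R / n`!%:R :> rat by rewrite divr_ge0 ?ler0n.
rewrite normrN (ger0_norm r0).
apply: (failure_ratio_le _ _ n%:R _ _ F0).
  by rewrite (ler_nat _ 100).
  apply: le_trans (card_few_twins n b b100 nb).
  by rewrite ler_wpM2r ?exprn_ge0 ?ler0n // ler_nat subset_leq_card.
by rewrite natr1 -natrX -natrM ler_nat ltnW.
Qed.

Theorem theorem2 :
  forall eps : rat, 0 < eps ->
  exists N : nat, forall n : nat, (N <= n)%N ->
    `|prob_long_twins n - 1| < eps.
Proof.
move=> eps eps0.
have q0 : 0 <= 3300 / eps := divr_ge0 (ler0n _ _) (ltW eps0).
have [B B100 epsB] : exists2 B, (100 <= B)%N & 3300 / eps < B%:R.
  move: (3300 / eps) q0 => x x0.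
  exists (maxn 100 (Num.bound x)); first exact: leq_maxl.
  by apply: lt_le_trans (archi_boundP x0) _; rewrite ler_nat leq_maxr.
exists (8 * B ^ 3)%N => n nB; have [b nb] := cube_block_size n.
(* From [8 * B ^ 3 <= n < 8 * b.+1 ^ 3], the block size of [n] is at least [B]. *)
have Bb : (B <= b)%N.
  have : (8 * B ^ 3 < 8 * b.+1 ^ 3)%N by case/andP: nb => _; apply: leq_ltn_trans.
  rewrite (@ltn_pmul2l 8 _ _ isT) (ltn_exp2r _ _ (isT : (0 < 3)%N)); exact: id.
have b100 : (100 <= b)%N by exact: leq_trans Bb.
apply: le_lt_trans (prob_long_twins_ge n b b100 nb) _.
have b0 : 0 < b%:R :> rat.
  rewrite ltr0n; exact: (@ltn_trans 99 0 b isT b100).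
rewrite (ltr_pdivrMr _ _ b0) mulrC -(ltr_pdivrMr _ _ eps0).
by apply: lt_le_trans epsB _; rewrite ler_nat.
Qed.
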